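(* Let $n\ge 4$, let $E=\{(i,j):1\le i<j\le n\}$, $S=\mathbb{C}[x_{i,j}:(i,j)\in E]$, and let $I=I_{2,n}\subset S$ be the Plücker ideal of the Grassmannian $\operatorname{Gr}(2,n)$. Let $w\in\mathbb{R}^E$ be such that $\operatorname{in}_wI$ contains no monomial. Then $I_w=\operatorname{in}_wI$, where $I_w$ is the ideal of $S$ generated by the subspaces $\rho_\Delta(I)$ over all cells $\Delta$ of $\operatorname{subd}_w\mathcal A(I)$.
   Context: The Plücker ideal $I_{2,n}$ is the kernel of $S\to\mathbb{C}[z_{ab}:1\le a\le 2,1\le b\le n]$, $x_{i,j}\mapsto z_{1i}z_{2j}-z_{1j}z_{2i}$. $\operatorname{in}_wp$ is the sum of the terms of $p$ of minimal $w$-weight, and $\operatorname{in}_wI$ is the ideal they generate. $\mathcal L(I)=\{w:\operatorname{in}_wI=I\}$. $\mathcal A(I)=(a_e)_{e\in E}\subset\mathcal L(I)^*$, where $a_e$ is the restriction of the $e$-th coordinate functional to $\mathcal L(I)$. $\operatorname{subd}_wA$, for $A=(a_e)$ in $V$, is the set of cells $(a_e)_{e\in E_f}$, for $f\in V^*$, with $E_f$ the set of $e$ minimizing $f(a_e)+w_e$. $\rho_\Delta:S\to\mathbb{C}[x_e:a_e\in\Delta]\subset S$ kills the variables not indexed by labels of $\Delta$. *)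

(* Defs.v *)
From HB Require Import structures.
From mathcomp Require Import all_boot all_order all_algebra.
From mathcomp Require Import complex mpoly.
From mathcomp Require Import boolp classical_sets reals.

Set Implicit Arguments.
Unset Strict Implicit.
Unset Printing Implicit Defensive.

Import Order.TTheory GRing.Theory Num.Theory.
Local Open Scope ring_scope.
Local Open Scope classical_set_scope.

Section Ideals.
Variable A : comNzRingType.

Definition is_ideal (I : set A) : Prop :=
  [/\ I 0, forall p q, I p -> I q -> I (p + q) & forall a p, I p -> I (a * p)].

Definition ideal_gen (G : set A) : set A := smallest is_ideal G.

End Ideals.

(* The polynomial ring over the complex numbers R[i] with variables x_e indexed
   by a finite type E; x_e is the variable of index enum_rank e. *)
Notation polyring R E := {mpoly (complex R)[#|E|]}.
Notation pvar e := ('X_(enum_rank e)).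

Section InitialIdeals.
Variables (R : realType) (E : finType).
Implicit Types (w : {ffun E -> R^o}) (m : 'X_{1..#|E|}) (p q : polyring R E).
Implicit Types (I : set (polyring R E)).

Definition wweight w m : R := \sum_(e : E) (m (enum_rank e))%:R * w e.

Definition initial_form w p : polyring R E :=
  \sum_(m <- msupp p |
        all (fun m' => wweight w m <= wweight w m') (msupp p))
     p@_m *: 'X_[m].

Definition initial_ideal w I : set (polyring R E) :=
  ideal_gen (initial_form w @` I).

(* The set { w | in_w I = I } as a linear subspace of R^E.  It is one whenever
   I is an ideal, see linealityP below; the default value 0 is then not used. *)
Definition lineality I : {vspace {ffun E -> R^o}} :=
  xget 0%VS [set U : {vspace {ffun E -> R^o}} |
              forall w, w \in U <-> initial_ideal w I = I].

Definition lineality_dual I : vectType R :=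
  'Hom(subvs_of (lineality I), R^o).

Definition lineality_config I (e : E) : lineality_dual I :=
  linfun (fun l : subvs_of (lineality I) => vsval l e).

Lemma lineality_configE I (e : E) (l : subvs_of (lineality I)) :
  lineality_config I e l = vsval l e.
Proof.
have lin : linear (fun l : subvs_of (lineality I) => vsval l e : R^o).
  by move=> a u v; rewrite linearP !ffunE.
pose f := HB.pack_for {linear subvs_of (lineality I) -> R^o}
  (fun l : subvs_of (lineality I) => vsval l e : R^o)
  (GRing.isLinear.Build _ _ _ _ _ lin).
exact: (lfunE f l).
Qed.

End InitialIdeals.

Section LinealityTheory.
Variables (R : realType) (E : finType).
Implicit Types (w v : {ffun E -> R^o}) (m : 'X_{1..#|E|}).
Implicit Types (p q : polyring R E) (P Q : pred 'X_{1..#|E|}).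

Let filt P p : polyring R E := \sum_(m <- msupp p | P m) p@_m *: 'X_[m].

Let mcoeff_filt P p m : (filt P p)@_m = if P m then p@_m else 0.
Proof.
rewrite /filt raddf_sum /=.
under eq_bigr => k _ do rewrite mcoeffZ mcoeffX.
have [mp|mp] := boolP (m \in msupp p); last first.
  rewrite big1_seq ?(memN_msupp_eq0 mp) ?if_same // => k /andP[_ kp].
  by case: eqP => [km|]; rewrite ?mulr0 // -km kp in mp *.
rewrite -big_filter; case: ifP => Pm.
  rewrite (bigD1_seq m) ?mem_filter ?Pm ?filter_uniq ?msupp_uniq //=.
  rewrite eqxx mulr1 big1 ?addr0 // => k /negPf ->.
  by rewrite mulr0.
rewrite big1_seq // => k /andP[_]; rewrite mem_filter => /andP[Pk _].
by case: eqP => [km|]; rewrite ?mulr0 // -km Pk in Pm *.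
Qed.

Let filt_size P p m : m \in msupp p -> P m ->
  (size (msupp (p - filt P p)) < size (msupp p))%N.
Proof.
move=> mp Pm.
have sub : {subset msupp (p - filt P p) <= msupp p}.
  move=> k; rewrite !mcoeff_msupp mcoeffB mcoeff_filt.
  by apply: contraNN => /eqP ->; rewrite if_same subr0.
have mN : m \notin msupp (p - filt P p).
  by rewrite mcoeff_msupp mcoeffB mcoeff_filt Pm subrr eqxx.
have /(uniq_leq_size _) : {subset m :: msupp (p - filt P p) <= msupp p}.
  by move=> k; rewrite inE => /predU1P[->//|/sub].
by apply; rewrite /= mN msupp_uniq.
Qed.

Variable I : set (polyring R E).
Hypothesis idI : is_ideal I.

Let idI0 : I 0. Proof. by case: idI. Qed.
Let idID p q : I p -> I q -> I (p + q).
Proof. by case: idI => _ + _; apply. Qed.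

Let idIB p q : I p -> I q -> I (p - q).
Proof.
by move=> Ip Iq; rewrite -mulN1r; apply: idID => //; case: idI => _ _; apply.
Qed.

Let wstable w :=
  forall c p, I p -> I (filt (fun m => wweight w m == c) p).

Let initial_formE w p m : m \in msupp p ->
  exists2 k, k \in msupp p &
    initial_form w p = filt (fun l => wweight w l == wweight w k) p.
Proof.
move=> mp.
have [k kp kmin] : exists2 k, k \in msupp p &
    forall l, l \in msupp p -> wweight w k <= wweight w l.
  elim: (msupp p) m mp => // a s IHs m _; case: s IHs => [|b s] IHs.
    by exists a => [|l]; rewrite inE // => /eqP->.
  have [k ks kmin] := IHs b (mem_head _ _).
  have [le|lt] := leP (wweight w a) (wweight w k).
    exists a; first exact: mem_head.
    move=> l; rewrite inE => /predU1P[->//|/kmin]; exact: le_trans.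
  exists k; first by rewrite inE ks orbT.
  by move=> l; rewrite inE => /predU1P[->|/kmin//]; exact: ltW.
exists k => //; apply/mpolyP => l.
rewrite [initial_form w p]/(filt (fun m => all _ _) p) !mcoeff_filt.
have [lp|lp] := boolP (l \in msupp p); last by rewrite memN_msupp_eq0 ?if_same.
congr (if _ then _ else _); apply/allP/eqP => [lmin|-> //].
by apply/eqP; rewrite eq_le lmin ?kmin.
Qed.

Let msupp_neq0 p : p != 0 -> exists m, m \in msupp p.
Proof.
rewrite -msupp_eq0; case: (msupp p) => // m s _.
by exists m; rewrite mem_head.
Qed.

Let msupp_ind (X : polyring R E -> Prop) :
  X 0 -> (forall p, p != 0 -> (forall q, (size (msupp q) < size (msupp p))%N ->
    X q) -> X p) -> forall p, X p.
Proof.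
move=> X0 XS p; have [k] := ubnP (size (msupp p)).
elim: k p => // k IHk p lepk; have [->//|p0] := eqVneq p 0.
by apply: XS => // q ltqp; apply: IHk; apply: leq_trans ltqp _.
Qed.

Let wstableP w : initial_ideal w I = I <-> wstable w.
Proof.
have stepI p : I p -> p != 0 ->
    exists2 k, k \in msupp p & initial_form w p =
      filt (fun l => wweight w l == wweight w k) p /\
      (size (msupp (p - initial_form w p)) < size (msupp p))%N.
  move=> _ /msupp_neq0[m mp]; have [k kp e] := initial_formE w mp.
  by exists k => //; split=> //; rewrite e; apply: (filt_size kp) => /=.
have gen p : I p -> initial_ideal w I (initial_form w p).
  by move=> Ip J [_]; apply; exists p.
split=> [eI c p|hI].
  elim/msupp_ind: p => [_|p p0 IHp Ip].
    suff -> : filt (fun m => wweight w m == c) 0 = 0 by [].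
    by apply/mpolyP => m; rewrite mcoeff_filt mcoeff0 if_same.
  have [k kp [e lt]] := stepI p Ip p0.
  have Iin : I (initial_form w p) by rewrite -eI; apply: gen.
  have [<-|ck] := eqVneq (wweight w k) c; first by rewrite -e.
  suff -> : filt (fun m => wweight w m == c) p =
            filt (fun m => wweight w m == c) (p - initial_form w p).
    by apply: IHp => //; apply: idIB.
  apply/mpolyP => m; rewrite e !mcoeff_filt mcoeffB mcoeff_filt.
  by case: eqP => // ->; rewrite eq_sym (negPf ck) subr0.
rewrite eqEsubset; split=> [p|].
  apply; split=> // _ [q Iq <-]; have [->|q0] := eqVneq q 0.
    by rewrite /initial_form msupp0 big_nil.
  by have [k _ [-> _]] := stepI q Iq q0; apply: hI.
elim/msupp_ind => [_|p p0 IHp Ip].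
  by move=> J [[]].
have [k kp [e lt]] := stepI p Ip p0.
have Iin : I (initial_form w p) by rewrite e; apply: hI.
rewrite -(subrK (initial_form w p) p) => J JI.
case: (JI) => -[_ JD _] _; apply: JD; last exact: (gen p Ip J JI).
by apply: (IHp _ lt _ J JI); apply: idIB.
Qed.

Let wstable2 w v P :
  (forall m k, wweight w m = wweight w k -> wweight v m = wweight v k ->
    P m = P k) ->
  wstable w -> wstable v -> forall p, I p -> I (filt P p).
Proof.
move=> wvP hw hv; elim/msupp_ind => [_|p p0 IHp Ip].
  suff -> : filt P 0 = 0 by [].
  by apply/mpolyP => m; rewrite mcoeff_filt mcoeff0 if_same.
have [k kp] := msupp_neq0 p0.
pose Q m := (wweight v m == wweight v k) && (wweight w m == wweight w k).
have IQ : I (filt Q p).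
  suff -> : filt Q p = filt (fun m => wweight v m == wweight v k)
    (filt (fun m => wweight w m == wweight w k) p) by apply/hv/hw.
  by apply/mpolyP => m; rewrite !mcoeff_filt /Q; case: eqP.
have Qk : Q k by rewrite /Q !eqxx.
have PQ m : Q m -> P m = P k by move=> /andP[/eqP mv /eqP mw]; apply: wvP.
have IB := IHp _ (filt_size kp Qk) (idIB Ip IQ).
suff -> : filt P p = filt P (p - filt Q p) + (if P k then filt Q p else 0).
  by apply: idID => //; case: ifP.
apply/mpolyP => m; rewrite mcoeffD !mcoeff_filt mcoeffB mcoeff_filt.
rewrite (fun_if (fun q : polyring R E => q@_m)) mcoeff0 mcoeff_filt.
case Qm: (Q m); last by rewrite subr0 if_same addr0.
by rewrite (PQ _ Qm) subrr if_same add0r.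
Qed.

Let wweight0 m : wweight (0 : {ffun E -> R^o}) m = 0.
Proof. by rewrite /wweight big1 // => e _; rewrite ffunE mulr0. Qed.

Let wweightD a w v m : wweight (a *: w + v) m = a * wweight w m + wweight v m.
Proof.
rewrite /wweight mulr_sumr -big_split /=; apply: eq_bigr => e _.
by rewrite !ffunE mulrDr mulrCA.
Qed.

Let wstable0 : wstable 0.
Proof.
move=> c p Ip; rewrite (_ : filt _ p = if 0 == c then p else 0).
  by case: ifP.
apply/mpolyP => m; rewrite mcoeff_filt wweight0.
by case: ifP; rewrite ?mcoeff0.
Qed.

Let wstableD a w v : wstable w -> wstable v -> wstable (a *: w + v).
Proof.
move=> hw hv c; apply: wstable2 hw hv => m k ew ev.
by rewrite !wweightD ew ev.
Qed.

Let subspace_ex (X : set {ffun E -> R^o}) :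
  X 0 -> (forall a u v, X u -> X v -> X (a *: u + v)) ->
  exists U : {vspace {ffun E -> R^o}}, forall u, u \in U <-> X u.
Proof.
move=> X0 XD.
pose D k := `[< exists2 U : {vspace {ffun E -> R^o}},
  \dim U = k & forall u, u \in U -> X u >].
have exD : exists k, D k.
  exists 0%N; apply/asboolP; exists 0%VS; first exact: dimv0.
  by move=> u; rewrite memv0 => /eqP->.
have ubD k : D k -> (k <= \dim {:{ffun E -> R^o}})%N.
  by move=> /asboolP[U <- _]; apply/dimvS/subvf.
case: (ex_maxnP exD ubD) => k /asboolP[U dU UX] kmax.
exists U => u; split=> [/UX//|Xu].
have: D (\dim (<[u]> + U)).
  apply/asboolP; exists (<[u]> + U)%VS => //.
  move=> _ /memv_addP[_ /vlineP[a ->]] [v vU ->].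
  by apply: XD => //; apply: UX.
move/kmax; rewrite -dU => le; have /eqP-> : U == (<[u]> + U)%VS.
  by rewrite eqEdim le addvSr.
by apply: subvP (addvSl _ _) _ _; apply: memv_line.
Qed.

Lemma linealityP w : w \in lineality I <-> initial_ideal w I = I.
Proof.
rewrite /lineality; case: xgetP => [U _ /(_ w)//|].
have [U UP] := subspace_ex wstable0 wstableD.
by move=> /(_ U) []; move=> v; rewrite UP wstableP.
Qed.

End LinealityTheory.

Section Subdivision.
Variables (R : realType) (E : finType) (V : vectType R).

(* A cell (a_e)_(e in E_f) is represented by its set of labels E_f. *)
Definition cell (w : {ffun E -> R^o}) (a : E -> V) (f : 'Hom(V, R^o)) :
    {set E} :=
  [set e | [forall e', f (a e) + w e <= f (a e') + w e']]%SET.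

Definition subd (w : {ffun E -> R^o}) (a : E -> V) : set {set E} :=
  range (cell w a).

End Subdivision.

Section SubdivisionIdeal.
Variables (R : realType) (E : finType).

Definition rho (D : {set E}) (p : polyring R E) : polyring R E :=
  p \mPo [tuple (if enum_val i \in D then 'X_i else 0) | i < #|E|].

Definition subd_ideal (w : {ffun E -> R^o}) (I : set (polyring R E)) :
    set (polyring R E) :=
  ideal_gen (\bigcup_(D in subd w (lineality_config I)) (rho D @` I)).

End SubdivisionIdeal.

Section Pluecker.
Variables (R : realType) (n : nat).

Definition pairs : finType := {e : 'I_n * 'I_n | (e.1 < e.2)%N}.

Definition entries : finType := ('I_2 * 'I_n)%type.

Local Notation z a b := (pvar ((a, b) : entries)).

Definition pluecker_minor (e : pairs) : polyring R entries :=
  let: (i, j) := val e in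
  z 0 i * z 1 j - z 0 j * z 1 i.

Definition pluecker_map (p : polyring R pairs) :
    polyring R entries :=
  p \mPo [tuple pluecker_minor (enum_val k) | k < #|pairs|].

Definition pluecker_ideal : set (polyring R pairs) :=
  [set p | pluecker_map p = 0].

Lemma pluecker_ideal_is_ideal : is_ideal pluecker_ideal.
Proof.
rewrite /pluecker_ideal /pluecker_map; split=> /= [|p q p0 q0|a p p0].
- by rewrite raddf0.
- by rewrite raddfD /= p0 q0 addr0.
- by rewrite rmorphM /= p0 mulr0.
Qed.

End Pluecker.

Arguments pluecker_ideal : clear implicits.

(* Main.v *)
From HB Require Import structures.
Require Import Defs.
From mathcomp Require Import all_boot all_order all_algebra.
From mathcomp Require Import complex mpoly.
From mathcomp Require Import boolp classical_sets reals.
From mathcomp Require Import ring lra zify.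

(* Cells lie in in_w I: a functional f on the dual of the lineality space is
   evaluation at some l with in_l I = I; after subtracting a constant, w + l is
   nonnegative and vanishes exactly on the cell, so on l-homogeneous elements of
   I the map rho is either zero or the initial form for w.

   Conversely, if in_w I has no monomial, the three-term Pluecker relations show
   that -w is a tree metric on {1, ..., n}. Embedding the tree in the plane
   orders its leaves on a circle, and in every three-term relation the crossing
   product x_ik x_jl has minimal weight. Rewriting crossing products expresses
   each monomial, modulo I and without decreasing weights, by noncrossing
   monomials, which are independent modulo I; hence in_w I is generated by the
   initial forms of the three-term relations. Such an initial form is the image
   of the relation under rho for the cell given by the branching point of three
   of its four leaves, via the distances from that point. *)

Set Implicit Arguments.
Unset Strict Implicit.
Unset Printing Implicit Defensive.

Import Order.TTheory GRing.Theory Num.Theory.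

(** * Ideals generated by a set *)

Section IdealTheory.
Local Open Scope ring_scope.
Local Open Scope classical_set_scope.
Variable A : comNzRingType.
Implicit Types (I J G : set A).

Lemma ideal_gen_ideal G : is_ideal (ideal_gen G).
Proof.
split=> [J [[]]//|p q Gp Gq J JG|a p Gp J JG].
  by case: (JG) => -[_ + _] _; apply; [apply: Gp|apply: Gq].
by case: (JG) => -[_ _ +] _; apply; apply: Gp.
Qed.

Lemma sub_ideal_gen G : G `<=` ideal_gen G.
Proof. by move=> p Gp J [_]; apply. Qed.

Lemma ideal_gen_min G J : is_ideal J -> G `<=` J -> ideal_gen G `<=` J.
Proof. by move=> idJ GJ p; apply. Qed.

Variable I : set A.
Hypothesis idI : is_ideal I.

Lemma ideal0 : I 0. Proof. by case: idI. Qed.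
Lemma idealD p q : I p -> I q -> I (p + q). Proof. by case: idI => _ + _; apply. Qed.
Lemma idealM a p : I p -> I (a * p). Proof. by case: idI => _ _; apply. Qed.
Lemma idealB p q : I p -> I q -> I (p - q).
Proof. by move=> Ip Iq; rewrite -mulN1r; apply: idealD => //; apply: idealM. Qed.
Lemma ideal_sum T (r : seq T) (P : pred T) F :
  (forall i, P i -> I (F i)) -> I (\sum_(i <- r | P i) F i).
Proof. by move=> IF; elim/big_ind: _ => //; [exact: ideal0|exact: idealD]. Qed.

End IdealTheory.

(** * Reflexivity of finite-dimensional spaces *)

Section DoubleDual.
Local Open Scope ring_scope.

(** Cells are indexed by functionals on the dual of the lineality space; this turns such a
    functional back into a lineality vector, whose coordinates are its values on the dual basis. *)
Lemma dual_eval (K : fieldType) (V : vectType K)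
  (f : 'Hom('Hom(V, K^o), K^o)) : exists v, forall g, f g = g v.
Proof.
pose b := vbasis {:V}.
pose c i : 'Hom(V, K^o) := linfun (coord b i : V -> K^o).
exists (\sum_(i < \dim {:V}) (f (c i) : K) *: b`_i) => g.
have {1}-> : g = \sum_(i < \dim {:V}) (g b`_i : K) *: c i.
  apply/lfunP => x; rewrite sum_lfunE {1}(coord_vbasis (memvf x)) linear_sum /=.
  by apply: eq_bigr => i _; rewrite linearZ /= scale_lfunE lfunE /= [RHS]mulrC.
rewrite !linear_sum /=; apply: eq_bigr => i _.
by rewrite !linearZ /= [RHS]mulrC.
Qed.

End DoubleDual.

Lemma seq_min (R : realDomainType) (T : eqType) (g : T -> R) (s : seq T) :
  s != [::] -> exists2 x, x \in s & forall y, y \in s -> (g x <= g y)%R.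
Proof.
elim: s => // a [_ _|b s IHs _].
  by exists a => [|l]; rewrite inE // => /eqP->.
have [k ks kmin] := IHs isT.
have [le|lt] := leP (g a) (g k).
  exists a; first exact: mem_head.
  by move=> l; rewrite inE => /predU1P[->//|/kmin]; apply: le_trans.
exists k; first by rewrite inE ks orbT.
by move=> l; rewrite inE => /predU1P[->|/kmin//]; exact: ltW.
Qed.

(** * Parts of a polynomial cut out by a condition on monomials *)

Section Parts.
Local Open Scope ring_scope.
Variables (K : comNzRingType) (n : nat).
Implicit Types (P : pred 'X_{1..n}) (p q : {mpoly K[n]}).

(** Common form of initial forms and of the maps [rho]: for fixed P it is linear in p. *)
Definition mpart P p : {mpoly K[n]} := \sum_(m <- msupp p | P m) p@_m *: 'X_[m].

Lemma mcoeff_mpart P p m : (mpart P p)@_m = if P m then p@_m else 0.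
Proof.
rewrite /mpart -big_filter raddf_sum /=.
under eq_bigr do rewrite mcoeffZ mcoeffX.
have [/andP[Pm mp]|Pmp] := boolP (P m && (m \in msupp p)).
  rewrite Pm (bigD1_seq m) ?filter_uniq ?mem_filter ?Pm //= eqxx mulr1.
  by rewrite big1 ?addr0 // => k /negPf ->; rewrite mulr0.
rewrite big1_seq => [|k]; last first.
  rewrite mem_filter /= => kP; case: eqP => [km|]; rewrite ?mulr0 //.
  by rewrite km (negPf Pmp) in kP.
by case: ifP Pmp => //= _ /memN_msupp_eq0.
Qed.

Lemma mpart_is_linear P : linear (mpart P).
Proof.
move=> a p q; apply/mpolyP => m.
by rewrite !(mcoeffD, mcoeffZ, mcoeff_mpart); case: ifP; rewrite ?mulr0 ?addr0.
Qed.
HB.instance Definition _ P :=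
  GRing.isLinear.Build K {mpoly K[n]} {mpoly K[n]} *:%R (mpart P)
    (mpart_is_linear P).

Lemma mpartX P m : mpart P 'X_[m] = if P m then 'X_[m] else 0.
Proof.
apply/mpolyP => k; rewrite mcoeff_mpart mcoeffX.
case: ifP => Pk; case: ifP => Pm; rewrite ?mcoeff0 ?mcoeffX //;
  by case: eqP => // e; rewrite -e Pm in Pk.
Qed.

Lemma eq_in_mpart P Q p :
  {in msupp p, P =1 Q} -> mpart P p = mpart Q p.
Proof.
move=> PQ; apply/mpolyP => m; rewrite !mcoeff_mpart.
have [/PQ->//|/memN_msupp_eq0->] := boolP (m \in msupp p).
by rewrite !if_same.
Qed.

Lemma mpart_pred0 P p : {in msupp p, forall m, ~~ P m} -> mpart P p = 0.
Proof.
by move=> P0; rewrite /mpart big1_seq // => m /andP[Pm /P0]; rewrite Pm.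
Qed.

Lemma mpart_predT P p : {in msupp p, forall m, P m} -> mpart P p = p.
Proof.
move=> PT; rewrite {2}[p]mpolyE /mpart big_seq_cond [RHS]big_seq.
by apply: eq_bigl => m; case: (boolP (_ \in _)) => // /PT ->.
Qed.

Lemma msupp_mpart P p m : (m \in msupp (mpart P p)) = P m && (m \in msupp p).
Proof.
by rewrite !mcoeff_msupp mcoeff_mpart; case: ifP => //; rewrite eqxx.
Qed.

Lemma size_msupp_mpart P p m : m \in msupp p -> P m ->
  (size (msupp (p - mpart P p)) < size (msupp p))%N.
Proof.
move=> mp Pm.
have -> : p - mpart P p = mpart (predC P) p.
  apply/mpolyP => k; rewrite mcoeffB !mcoeff_mpart /=.
  by case: (P k); rewrite ?subrr ?subr0.
have /(uniq_leq_size _) : {subset m :: msupp (mpart (predC P) p) <= msupp p}.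
  by move=> k; rewrite inE msupp_mpart => /predU1P[->//|/andP[]].
by apply; rewrite /= msupp_mpart /= Pm msupp_uniq.
Qed.

End Parts.

(** * Weights, initial forms and the maps [rho] *)

Section InitialForms.
Local Open Scope ring_scope.
Local Open Scope classical_set_scope.
Variables (R : realType) (E : finType).
Implicit Types (w l : {ffun E -> R^o}) (p q : polyring R E) (D : {set E}).
Implicit Types (m : 'X_{1..#|E|}) (I : set (polyring R E)).

Lemma wweightD w m1 m2 : wweight w (m1 + m2)%MM = wweight w m1 + wweight w m2.
Proof.
rewrite /wweight -big_split /=; apply: eq_bigr => e _.
by rewrite mnmDE natrD mulrDl.
Qed.

Lemma wweightU w e : wweight w U_(enum_rank e)%MM = w e.
Proof.
rewrite /wweight (bigD1 e) //= mnm1E eqxx mul1r big1 ?addr0 // => f fe.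
by rewrite mnm1E (inj_eq enum_rank_inj) eq_sym (negPf fe) mul0r.
Qed.

Lemma wweight_add w l m : wweight (w + l) m = wweight w m + wweight l m.
Proof.
rewrite /wweight -big_split /=; apply: eq_bigr => e _.
by rewrite ffunE mulrDr.
Qed.

Lemma initial_form0 w : initial_form w 0 = 0.
Proof. by rewrite /initial_form msupp0 big_nil. Qed.

(** The condition defining [initial_form] involves the whole support of p; once a minimizing
    monomial k is fixed, it concerns one monomial at a time and linearity of [mpart] applies. *)
Lemma initial_formE w p k : k \in msupp p ->
  (forall m, m \in msupp p -> wweight w k <= wweight w m) ->
  initial_form w p = mpart (fun m => wweight w m == wweight w k) p.
Proof.
move=> kp kmin; rewrite -[LHS]/(mpart (fun m => all _ _) p).
apply: eq_in_mpart => m mp; apply/allP/eqP => [mmin|-> //].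
by apply/eqP; rewrite eq_le mmin ?kmin.
Qed.

Lemma initial_formP w p : p != 0 -> exists2 k, k \in msupp p &
  (forall m, m \in msupp p -> wweight w k <= wweight w m) /\
  initial_form w p = mpart (fun m => wweight w m == wweight w k) p.
Proof.
rewrite -msupp_eq0 => /(seq_min (wweight w))[k kp kmin].
by exists k => //; split=> //; apply: initial_formE.
Qed.

Lemma mem_initial_ideal w I p : I p -> initial_ideal w I (initial_form w p).
Proof. by move=> Ip; apply: sub_ideal_gen; exists p. Qed.

(* Peeling off initial forms one after the other exhausts a polynomial. *)
Lemma initial_form_ind w I (X : polyring R E -> Prop) : is_ideal I ->
  (forall p, I p -> I (initial_form w p)) ->
  X 0 -> (forall p q, X p -> X q -> X (p + q)) ->
  (forall p, I p -> p != 0 -> X (initial_form w p)) -> forall p, I p -> X p.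
Proof.
move=> idI stab X0 XD Xin p; have [k] := ubnP (size (msupp p)).
elim: k p => // k IHk p lepk Ip; have [->//|p0] := eqVneq p 0.
rewrite -(subrK (initial_form w p) p); apply: XD; last exact: Xin.
apply: IHk; last by apply: idealB => //; apply: stab.
have [h hp [_ ->]] := initial_formP w p0.
by apply: leq_trans (size_msupp_mpart hp _) _ => /=.
Qed.

Lemma initial_ideal_stable w I : is_ideal I ->
  (forall p, I p -> I (initial_form w p)) -> initial_ideal w I = I.
Proof.
move=> idI stab; rewrite eqEsubset; split=> [|p Ip].
  by apply: ideal_gen_min => // _ [p Ip <-]; apply: stab.
have idw : is_ideal (initial_ideal w I) by apply: ideal_gen_ideal.
apply: (initial_form_ind (w := w)) Ip => //.
- exact: ideal0.
- exact: idealD.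
- by move=> q Iq _; apply: mem_initial_ideal.
Qed.

Definition mnm_in D m := [forall e, (m (enum_rank e) != 0%N) ==> (e \in D)].

(** Substituting 0 kills exactly the monomials involving a variable outside D. *)
Lemma rhoE D p : rho D p = mpart (mnm_in D) p.
Proof.
rewrite /rho /mpart [LHS]comp_mpolyEX [RHS]big_mkcond /=; apply: eq_bigr => m _.
rewrite comp_mpolyX; case: ifPn => [/forallP mD|].
  congr (_ *: _); rewrite mpolyXE_id; apply: eq_bigr => i _.
  rewrite tnth_mktuple; have := mD (enum_val i); rewrite enum_valK.
  by case: eqP => [->|_ /= ->//]; rewrite !expr0.
rewrite negb_forall => /existsP[e]; rewrite negb_imply => /andP[me eD].
rewrite (bigD1 (enum_rank e)) //= tnth_mktuple enum_rankK (negPf eD).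
by rewrite expr0n (negPf me) mul0r scaler0.
Qed.

End InitialForms.

(** * Cells as minimizers of w + l with l in the lineality space *)

Section SubdivisionIdeals.
Local Open Scope ring_scope.
Local Open Scope classical_set_scope.
Variables (R : realType) (E : finType).
Implicit Types (w l : {ffun E -> R^o}) (p q : polyring R E) (D : {set E}).
Implicit Types (m : 'X_{1..#|E|}) (I : set (polyring R E)).

Lemma wweight_ge0 l m : (forall e, 0 <= l e) -> 0 <= wweight l m.
Proof. by move=> l0; apply: sumr_ge0 => e _; rewrite mulr_ge0. Qed.

Lemma wweight_eq0 l D m : (forall e, 0 <= l e) ->
  (forall e, (e \in D) = (l e == 0)) -> (wweight l m == 0) = mnm_in D m.
Proof.
move=> l0 lD; rewrite /wweight psumr_eq0; last by move=> e _; rewrite mulr_ge0.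
apply/allP/forallP => [+ e|+ e _] => /(_ e).
  rewrite mem_index_enum => /(_ isT) /=; rewrite mulf_eq0 pnatr_eq0 lD.
  by case: eqP.
by rewrite /= mulf_eq0 pnatr_eq0 lD; case: eqP.
Qed.

(** The functional defining the cell is evaluation at a lineality vector l, so its value at the
    label e is [l e], and mu is the minimum of w + l. *)
Lemma cell_weight w I (D : {set E}) : subd w (lineality_config I) D ->
  exists l mu, [/\ l \in lineality I, (forall e, mu <= w e + l e) &
    forall e, (e \in D) = (w e + l e == mu)].
Proof.
move=> [f _ <-]; have [v fv] := dual_eval f.
have fe e : f (lineality_config I e) = vsval v e by rewrite fv lineality_configE.
pose g e := w e + vsval v e.
have [mu [mule muD]] : exists mu, (forall e, mu <= g e) /\
    forall e, (e \in cell w (lineality_config I) f) = (g e == mu).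
  (* Without labels there is no minimum, and any value of mu will do. *)
  case: (pickP (fun _ : E => true)) => [e0 _|E0]; last by exists 0; split=> e; have := E0 e.
  case: (arg_minP (P := predT) g (erefl : predT e0)) => e1 _ e1min.
  exists (g e1); split=> [e|e]; first exact: e1min.
  rewrite inE; apply/forallP/eqP => [/(_ e1)|ge e'].
    by rewrite !fe ![_ + w _]addrC => le; apply/eqP; rewrite eq_le le e1min.
  by rewrite !fe ![_ + w _]addrC; rewrite -/(g e) ge; apply: e1min.
by exists (vsval v), mu; split=> //; apply: subvsP.
Qed.

Lemma sub_subd_ideal_initial w I : is_ideal I ->
  initial_ideal [ffun=> 1] I = I -> subd_ideal w I `<=` initial_ideal w I.
Proof.
move=> idI homI; have idw : is_ideal (initial_ideal w I) by apply: ideal_gen_ideal.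
apply: ideal_gen_min => // _ [D /cell_weight[l [mu [lI mule lD]]] [p Ip <-]].
(* Homogeneity of I puts the constant vectors in the lineality space, so the minimum can be shifted
   to 0. *)
pose l' := l - mu *: [ffun=> 1].
have l'I : initial_ideal l' I = I.
  by apply/linealityP => //; rewrite memvB // memvZ //; apply/linealityP.
have wlE e : (w + l') e = w e + l e - mu by rewrite !ffunE [_ *: _]mulr1 addrA.
have wl0 e : 0 <= (w + l') e by rewrite wlE subr_ge0.
have wlD e : (e \in D) = ((w + l') e == 0) by rewrite wlE subr_eq0.
have stab q : I q -> I (initial_form l' q).
  by move=> Iq; rewrite -l'I; apply: mem_initial_ideal.
(* It suffices to treat l'-initial forms: on their monomials the l'-weight is constant, so w and w +
   l' select the same lowest terms. *)
apply: (initial_form_ind (w := l') (I := I)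
  (X := fun q => initial_ideal w I (rho D q))) Ip => [//|//||q r|q Iq q0].
- by rewrite rhoE linear0; apply: ideal0.
- by rewrite !rhoE linearD; apply: idealD.
have Iq' := stab _ Iq; have [k _ [_ e]] := initial_formP l' q0.
set q' := initial_form l' q in Iq' e *.
have wE m : m \in msupp q' -> wweight w m = wweight (w + l') m - wweight l' k.
  by rewrite e msupp_mpart wweight_add => /andP[/eqP->]; rewrite addrK.
rewrite rhoE; have [/hasP[h hq hD]|/hasPn nD] := boolP (has (mnm_in D) (msupp q')).
  suff -> : mpart (mnm_in D) q' = initial_form w q' by apply: mem_initial_ideal.
  have h0 : wweight (w + l') h = 0 by apply/eqP; rewrite (wweight_eq0 _ wl0 wlD).
  rewrite (initial_formE hq) => [|m mq].
    apply: eq_in_mpart => m mq.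
    by rewrite !wE // h0 (can_eq (addrK _)) (wweight_eq0 _ wl0 wlD).
  by rewrite !wE // h0 lerD2r wweight_ge0.
by rewrite mpart_pred0 //; apply: ideal0.
Qed.

(** Converse of [cell_weight]: evaluation at l is the required functional, and e0 is a label where w
    + l attains its minimum. *)
Lemma subd_lineality w I l (D : {set E}) e0 : l \in lineality I ->
  (forall e, w e0 + l e0 <= w e + l e) ->
  (forall e, (e \in D) = (w e + l e == w e0 + l e0)) ->
  subd w (lineality_config I) D.
Proof.
move=> lI le0 lD.
pose v : subvs_of (lineality I) := Subvs lI.
have lin : linear (fun g : lineality_dual I => g v : R^o).
  by move=> a g h; rewrite add_lfunE scale_lfunE.
pose f := HB.pack_for {linear lineality_dual I -> R^o}
  (fun g : lineality_dual I => g v : R^o) (GRing.isLinear.Build _ _ _ _ _ lin).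
exists (linfun f) => //; apply/setP => e; rewrite inE lD.
have fE e' : linfun f (lineality_config I e') = l e'.
  by rewrite lfunE /= lineality_configE.
apply/forallP/eqP => [/(_ e0)|e1 e'].
  by rewrite !fE ![l _ + _]addrC => le; apply/eqP; rewrite eq_le le le0.
by rewrite !fE ![l _ + _]addrC e1.
Qed.

End SubdivisionIdeals.

(** * Column gradings of the Plücker ideal *)

Section PlueckerGrading.
Local Open Scope ring_scope.
Local Open Scope classical_set_scope.
Variables (R : realType) (n : nat).
Implicit Types (p q : polyring R (pairs n)) (m : 'X_{1..#|pairs n|}).

HB.instance Definition _ := GRing.RMorphism.copy (@pluecker_map R n)
  (comp_mpoly [tuple @pluecker_minor R n (enum_val k) | k < #|pairs n|]).
HB.instance Definition _ := GRing.Linear.copy (@pluecker_map R n)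
  (comp_mpoly [tuple @pluecker_minor R n (enum_val k) | k < #|pairs n|]).

Lemma pluecker_mapX m :
  pluecker_map 'X_[m] = \prod_(e : pairs n) @pluecker_minor R n e ^+ m (enum_rank e).
Proof.
rewrite /pluecker_map comp_mpolyX (reindex_onto enum_rank enum_val) /=; last first.
  by move=> i _; rewrite enum_valK.
apply: eq_big => [e|e _]; first by rewrite enum_rankK eqxx.
by rewrite tnth_mktuple enum_rankK.
Qed.

Lemma pluecker_mapE p :
  pluecker_map p = \sum_(m <- msupp p) p@_m *: pluecker_map 'X_[m].
Proof.
rewrite {1}[p]mpolyE linear_sum /=; apply: eq_bigr => m _.
by rewrite linearZ.
Qed.

Lemma pluecker_mapU (e : pairs n) : pluecker_map (pvar e) = pluecker_minor R e.
Proof. by rewrite /pluecker_map comp_mpolyXU -tnth_nth tnth_mktuple enum_rankK. Qed.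

Variable u : 'I_n -> R.
Let l : {ffun pairs n -> R^o} := [ffun e => u (val e).1 + u (val e).2].
Let v : {ffun entries n -> R^o} := [ffun x => u x.2].

Let graded c (p : polyring R (entries n)) :=
  forall h, h \in msupp p -> wweight v h = c.

Let gradedM c d (p q : polyring R (entries n)) : graded c p -> graded d q -> graded (c + d) (p * q).
Proof.
move=> pc qd m /msuppM_le/allpairsP[[a b] /= [ap bq ->]].
by rewrite wweightD (pc _ ap) (qd _ bq).
Qed.

Let gradedX c (p : polyring R (entries n)) k : graded c p -> graded (k%:R * c) (p ^+ k).
Proof.
move=> pc; elim: k => [|k IHk].
  move=> m; rewrite expr0 mul0r msupp1 inE => /eqP->.
  by rewrite /wweight big1 // => e _; rewrite mnm0E mul0r.
by rewrite exprS -natr1 mulrDl mul1r addrC; apply: gradedM.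
Qed.

Let graded_map m : graded (wweight l m) (pluecker_map 'X_[m]).
Proof.
rewrite pluecker_mapX /wweight; apply: (big_ind2 graded) => [|c p d q|e _].
- move=> k; rewrite msupp1 inE => /eqP->.
  by rewrite /wweight big1 // => e _; rewrite mnm0E mul0r.
- exact: gradedM.
apply: gradedX => k; rewrite /pluecker_minor ffunE.
case: (val e) => i j /= /msuppB_le; rewrite mem_cat -!mpolyXD !msuppX !inE.
by case/orP => /eqP->; rewrite wweightD !wweightU !ffunE //= addrC.
Qed.

(** Give both matrix entries in column i degree [u i]. The minor of columns i and j is then
    homogeneous of degree [u i + u j], so [pluecker_map] is graded and its kernel contains the
    homogeneous parts of its elements. *)
Lemma lineality_pluecker : l \in lineality (pluecker_ideal R n).
Proof.
have idI := pluecker_ideal_is_ideal R n.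
apply/(linealityP idI); apply: (initial_ideal_stable idI) => p Ip.
have [->|p0] := eqVneq p 0; first by rewrite initial_form0; apply: (ideal0 idI).
have [k _ [_ ->]] := initial_formP l p0; set c := wweight l k.
suff : pluecker_map (mpart (fun m => wweight l m == c) p) =
    mpart (fun h => wweight v h == c) (pluecker_map p).
  by rewrite /pluecker_ideal /= => ->; rewrite [pluecker_map p]Ip linear0.
rewrite [in RHS]pluecker_mapE {1}/mpart !linear_sum /= big_mkcond /=.
apply: eq_bigr => m _; rewrite !linearZ /=.
have [mc|mc] := ifPn.
  rewrite mpart_predT // => h /graded_map ->; exact: mc.
by rewrite mpart_pred0 ?scaler0 // => h /graded_map ->.
Qed.

End PlueckerGrading.

Lemma homogeneous_pluecker (R : realType) n :
  initial_ideal [ffun=> 1%R] (pluecker_ideal R n) = pluecker_ideal R n.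
Proof.
apply/(linealityP (pluecker_ideal_is_ideal R n)).
(* The standard grading is the column grading with degree 1/2 in every column. *)
have -> : [ffun=> 1%R] = [ffun=> 2^-1 + 2^-1]%R :> {ffun pairs n -> R^o}.
  by apply/ffunP => e; rewrite !ffunE; lra.
exact: (lineality_pluecker (fun=> 2^-1%R)).
Qed.

(** * Tree metrics: circular orders and branching points *)

Section TreeMetrics.
Local Open Scope ring_scope.
Variable R : realFieldType.

(** With proximity to a new point as g and position as h, this finds the last among the closest
    points. *)
Lemma lexmax_seq (T : eqType) (g : T -> R) (h : T -> nat) (x0 : T) s :
  exists2 y, y \in x0 :: s & forall z, z \in x0 :: s ->
    g z < g y \/ g z = g y /\ (h z <= h y)%N.
Proof.
elim: s x0 => [|x s IHs] x0.
  by exists x0 => [|z]; rewrite inE // => /eqP->; right.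
have [y ys ymax] := IHs x.
have [lt|gt|e] := ltgtP (g x0) (g y).
- exists y => [|z]; first by rewrite inE ys orbT.
  by rewrite inE => /predU1P[->|/ymax//]; left.
- exists x0 => [|z]; first by rewrite inE eqxx.
  rewrite inE => /predU1P[->|/ymax zy]; first by right.
  by left; case: zy => [/lt_trans->//|[->]].
have [le|lt] := leqP (h x0) (h y).
  exists y => [|z]; first by rewrite inE ys orbT.
  by rewrite inE => /predU1P[->|/ymax//]; right.
exists x0 => [|z]; first by rewrite inE eqxx.
rewrite inE => /predU1P[->|/ymax zy]; first by right.
rewrite e; case: zy => [|[-> zy]]; [by left|right; split=> //].
by apply: leq_trans zy (ltnW lt).
Qed.

(* The points are inserted one by one, a new point being placed just after the
   last one among those closest to it (G measures proximity). *)
Lemma ultrametric_order (T : eqType) (G : T -> T -> R) (s : seq T) :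
  (forall a b, G a b = G b a) -> uniq s ->
  {in s & s & s, forall a b c, uniq [:: a; b; c] ->
     G a b <= G a c \/ G b c <= G a c} ->
  exists2 pos : T -> nat, {in s &, injective pos} &
    {in s & s & s, forall a b c, (pos a < pos b < pos c)%N ->
       G a c <= G a b /\ G a c <= G b c}.
Proof.
move=> Gsym; elim: s => [_ _|x [|x0 s] IHs]; first by exists (fun=> 0%N).
  move=> _ _; exists (fun=> 0%N) => [a b|a b c]; rewrite !inE // => /eqP-> /eqP->//.
set t := x0 :: s in IHs *; rewrite cons_uniq => /andP[xt ut] ultra.
have sub a : a \in t -> a \in x :: t by rewrite inE orbC => ->.
have [|pos pos_inj posP] := IHs ut.
  by move=> a b c at_ bt ct; apply: ultra; apply: sub.
have [y yt ymax] := lexmax_seq (G x) pos x0 s.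
have neqx a : a \in t -> a == x = false.
  by move=> at_; apply: contraNF xt => /eqP<-.
(* In the triangle x, y, z the smallest proximity occurs twice, and [G x z] is smallest because y is
   closest to x. *)
have isoL z : z \in t -> [/\ G x z <= G x y, z != y -> G x z <= G z y &
    z != y -> G x z = G z y \/ G x z = G x y].
  move=> zt; have lez : G x z <= G x y by case: (ymax z zt) => [/ltW|[->]].
  split=> // zy; have xz := neqx z zt; have xy := neqx y yt;
    have xI : x \in x :: t by rewrite mem_head.
  have /(ultra z x y (sub z zt) xI (sub y yt)) : uniq [:: z; x; y].
    by rewrite /= !inE xz zy eq_sym xy.
  by rewrite (Gsym z x); case=> // /(le_trans lez).
  have /(ultra x y z xI (sub y yt) (sub z zt)) : uniq [:: x; y; z].
    by rewrite /= !inE ![x == _]eq_sym xy xz eq_sym zy.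
  have /(ultra z x y (sub z zt) xI (sub y yt)) : uniq [:: z; x; y].
    by rewrite /= !inE xz zy eq_sym xy.
  rewrite (Gsym z x) (Gsym y z) => h1 h2.
  have h3 : G x z <= G z y by case: h1 => // /(le_trans lez).
  by case: h2 => h2; [right|left]; apply/eqP; rewrite eq_le h2 ?lez ?h3.
(* By the tie-breaking, points after y are strictly less close to x than y is, so x and y have the
   same proximity to them. *)
have isoR z : z \in t -> (pos y < pos z)%N -> G x z = G y z /\ G y z <= G x y.
  move=> zt lt; have [lez _] := isoL z zt; rewrite (Gsym y z).
  case: (ymax z zt) => [ltz|[_]]; last by rewrite leqNgt lt.
  have zy : z != y by apply: contraTneq lt => ->; rewrite ltnn.
  by case/(_ zy) => e; [rewrite -e lez|rewrite e ltxx in ltz].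
pose pos' z := if z == x then (pos y).+1 else
  if (pos z <= pos y)%N then pos z else (pos z).+1.
have pos'x : pos' x = (pos y).+1 by rewrite /pos' eqxx.
have pos't a : a \in t -> pos' a = if (pos a <= pos y)%N then pos a else (pos a).+1.
  by move=> at_; rewrite /pos' neqx.
have lt_pos a b : a \in t -> b \in t -> (pos' a < pos' b)%N -> (pos a < pos b)%N.
  by move=> at_ bt; rewrite !pos't //; case: (leqP (pos a) (pos y)); case: (leqP (pos b) (pos y)); lia.
have gt_x a : a \in t -> (pos' x < pos' a)%N -> (pos y < pos a)%N.
  by move=> at_; rewrite pos'x pos't //; case: (leqP (pos a) (pos y)); lia.
have lt_x a : a \in t -> (pos' a < pos' x)%N -> a = y \/ (pos a < pos y)%N.
  move=> at_; rewrite pos'x pos't // => lt.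
  have {lt} le : (pos a <= pos y)%N by move: lt; case: (leqP (pos a) (pos y)); lia.
  have [->|ay] := eqVneq a y; [by left|right].
  have := contra_neq (pos_inj a y at_ yt) ay; lia.
exists pos'.
  move=> a b; rewrite !inE => /predU1P[->|at_] /predU1P[->|bt] //.
  - by rewrite pos'x pos't //; case: (leqP _ (pos y)) => le e; exfalso; lia.
  - by rewrite pos'x pos't //; case: (leqP _ (pos y)) => le e; exfalso; lia.
  by rewrite !pos't // => e; apply: pos_inj => //; move: e; case: (leqP (pos a) (pos y)); case: (leqP (pos b) (pos y)); lia.
(* Cases by the place of x in the triple: at both ends (absurd), first, middle, last, absent.
   Comparisons with x are reduced to y, its immediate predecessor. *)
move=> a b c; rewrite !inE => /predU1P[->|at_] /predU1P[->|bt] /predU1P[->|ct];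
  rewrite ?ltnn ?andbF //= => /andP[ab bc].
- by have := ltn_trans ab bc; rewrite ltnn.
- have yb := gt_x b bt ab; have bc' := lt_pos b c bt ct bc.
  have [-> _] := isoR b bt yb; have [-> _] := isoR c ct (ltn_trans yb bc').
  by apply: (posP y b c) => //; rewrite yb.
- have yc := gt_x c ct bc; have [-> ycx] := isoR c ct yc; rewrite (Gsym a x).
  case: (lt_x a at_ ab) => [->|ay] //.
  have [i1 i2] : G a c <= G a y /\ G a c <= G y c by apply: posP => //; rewrite ay.
  have ay_ : a != y by apply: contraTneq ay => ->; rewrite ltnn.
  split=> //; have [_ _ /(_ ay_)[->//|->]] := isoL a at_.
  exact: le_trans i2 ycx.
- have ab' := lt_pos a b at_ bt ab; rewrite (Gsym a x) (Gsym b x).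
  have [xay + _] := isoL a at_; case: (lt_x b bt bc) => [eb|yb].
    move: ab'; rewrite {}eb => ay.
    by rewrite xay => ->; last by apply: contraTneq ay => ->; rewrite ltnn.
  have ay : (pos a < pos y)%N by apply: ltn_trans yb.
  have ay_ : a != y by apply: contraTneq ay => ->; rewrite ltnn.
  have by_ : b != y by apply: contraTneq yb => ->; rewrite ltnn.
  move=> /(_ ay_) xaay; have [|i1 i2] := posP a b y at_ bt yt; first by rewrite ab'.
  split; first exact: le_trans xaay i1.
  by have [_ _ /(_ by_)[->|->]] := isoL b bt; [apply: le_trans xaay i2|].
by apply: posP => //; rewrite !lt_pos.
Qed.

Variables (T : finType) (W : T -> T -> R).
Hypothesis Wsym : forall a b, W a b = W b a.
Hypothesis four_point : forall i j k l, uniq [:: i; j; k; l] ->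
  W i k + W j l <= W i j + W k l \/ W i l + W j k <= W i j + W k l.

(* The Gromov product with respect to a root is an ultrametric. *)
Lemma circular_order : exists2 pos : T -> nat, injective pos &
  forall i j k l, (pos i < pos j)%N -> (pos j < pos k)%N -> (pos k < pos l)%N ->
    W i k + W j l <= W i j + W k l /\ W i k + W j l <= W i l + W j k.
Proof.
case: (pickP (fun _ : T => true)) => [r _|T0]; last first.
  by exists (fun=> 0%N) => i; have := T0 i.
(* Twice the Gromov product at r for the distance -W. *)
pose G a b := W a b - W a r - W b r.
have Gsym a b : G a b = G b a by rewrite /G Wsym addrAC.
have [||pos pos_inj posP] := @ultrametric_order T G (enum (predC1 r)) Gsym.
- exact: enum_uniq.
- move=> a b c; rewrite !mem_enum !inE => ar br cr uabc.
  have : uniq [:: a; c; b; r].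
    by move: uabc; rewrite /= !inE (eq_sym c b) !negb_or !andbT (negPf ar) (negPf br) (negPf cr) /= => /andP[/andP[-> ->] ->].
  by case/four_point => h; [left|right]; rewrite /G; have := Wsym c b; lra.
(* The root comes first, so among four points in increasing position only the first can be the
   root. *)
pose pos' z := if z == r then 0%N else (pos z).+1.
exists pos'.
  move=> a b; rewrite /pos'; case: eqP => [->|/eqP ar]; case: eqP => [->|/eqP br] // [].
  by apply: pos_inj; rewrite mem_enum.
have posN z i : (pos' i < pos' z)%N -> z != r.
  by apply: contraTneq => ->; rewrite /pos' eqxx.
have posG a b c : a != r -> b != r -> c != r -> (pos' a < pos' b)%N ->
    (pos' b < pos' c)%N -> G a c <= G a b /\ G a c <= G b c.
  move=> ar br cr; rewrite /pos' (negPf ar) (negPf br) (negPf cr) !ltnS => ab bc.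
  by apply: posP; rewrite ?mem_enum // ab.
move=> i j k l ij jk kl.
have [jr kr lr] := And3 (posN _ _ ij) (posN _ _ jk) (posN _ _ kl).
have := posG j k l jr kr lr jk kl; have [->|ir] := eqVneq i r.
  rewrite /G ![W r _]Wsym; lra.
have := posG i j k ir jr kr ij jk.
(* The comparison with ij + kl is a sum of two inequalities for triples. For il + jk, the four-point
   condition bounds it below by ij + kl or directly by ik + jl. *)
have : uniq [:: i; l; j; k].
  have ne a b : (pos' a < pos' b)%N -> (a == b = false) * (b == a = false).
    by move=> lt; split; apply: contraTF lt => /eqP->; rewrite ltnn.
  rewrite /= !inE (ne i j) // (ne j k) // (ne k l) // (ne i k) ?(ne j l) ?(ne i l) //;
    lia.
by move=> /four_point; rewrite /G (Wsym l k) (Wsym l j); lra.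
Qed.

(* u a is the distance from a to the branching point of i, j and k in the
   tree with leaf distances -W. *)
Lemma tree_point i j k l : uniq [:: i; j; k; l] -> exists u : T -> R,
  [/\ forall a b, a != b -> 0 <= W a b + (u a + u b),
      W i j + (u i + u j) = 0, W i k + (u i + u k) = 0, W j k + (u j + u k) = 0 &
  [/\ (W i l + (u i + u l) == 0) =
      (W i l + W j k <= W i j + W k l) && (W i l + W j k <= W i k + W j l),
      (W j l + (u j + u l) == 0) =
      (W i k + W j l <= W i j + W k l) && (W i k + W j l <= W i l + W j k) &
      (W k l + (u k + u l) == 0) =
      (W i j + W k l <= W i k + W j l) && (W i j + W k l <= W i l + W j k)]].
Proof.
move=> uijkl.
have [nij nik nil] : [/\ i != j, i != k & i != l].
  by move: uijkl; rewrite /= !inE !negb_or => /andP[/and3P[-> -> ->]].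
have [njk njl nkl] : [/\ j != k, j != l & k != l].
  by move: uijkl; rewrite /= !inE !negb_or => /and4P[_ /andP[-> ->] -> _].
(* The values [ui], [uj], [uk] solve the three linear equations that make the pairs ij, ik, jk
   vanish. *)
pose ui := (W j k - W i j - W i k) / 2.
pose uj := (W i k - W i j - W j k) / 2.
pose uk := (W i j - W i k - W j k) / 2.
(* The least value keeping the pairs of a with i, j and k nonnegative; at least one of these pairs
   vanishes. *)
pose v a := Num.max (- W i a - ui) (Num.max (- W j a - uj) (- W k a - uk)).
have vge a : [/\ 0 <= W i a + (ui + v a), 0 <= W j a + (uj + v a) &
    0 <= W k a + (uk + v a)].
  have h1 : - W i a - ui <= v a by rewrite le_max lexx.
  have h2 : - W j a - uj <= v a by rewrite !le_max lexx orbT.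
  have h3 : - W k a - uk <= v a by rewrite !le_max lexx !orbT.
  by split; lra.
have veq a : [\/ v a = - W i a - ui, v a = - W j a - uj | v a = - W k a - uk].
  rewrite /v; case: leP => _; last by constructor 1.
  by case: leP => _; [constructor 3|constructor 2].
pose u a := if a == i then ui else if a == j then uj else if a == k then uk else v a.
have uiE : u i = ui by rewrite /u eqxx.
have ujE : u j = uj by rewrite /u eq_sym (negPf nij) eqxx.
have ukE : u k = uk by rewrite /u ![k == _]eq_sym (negPf nik) (negPf njk) eqxx.
have ulE : u l = v l.
  by rewrite /u ![l == _]eq_sym (negPf nil) (negPf njl) (negPf nkl).
have uij : W i j + (ui + uj) = 0 by rewrite /ui /uj; lra.
have uik : W i k + (ui + uk) = 0 by rewrite /ui /uk; lra.
have ujk : W j k + (uj + uk) = 0 by rewrite /uj /uk; lra.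
have base b p : p \in [:: i; j; k] -> b != p -> 0 <= W p b + (u p + u b).
  have [vi vj vk] := vge b.
  rewrite !inE => /or3P[] /eqP-> bp; rewrite ?uiE ?ujE ?ukE /u.
  - rewrite (negPf bp); case: eqP => [->|_]; first lra.
    by case: eqP => [->|_]; lra.
  - case: eqP => [->|_]; first by rewrite Wsym; lra.
    by rewrite (negPf bp); case: eqP => [->|_]; lra.
  case: eqP => [->|_]; first by rewrite Wsym; lra.
  case: eqP => [->|_]; first by rewrite Wsym; lra.
  by rewrite (negPf bp).
exists u; split; rewrite ?uiE ?ujE ?ukE //.
  move=> a b ab; have [aB|aB] := boolP (a \in [:: i; j; k]).
    by apply: base => //; rewrite eq_sym.
  have [bB|bB] := boolP (b \in [:: i; j; k]).
    by rewrite Wsym [u a + _]addrC; apply: base.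
  have [ai aj ak] : [/\ a == i = false, a == j = false & a == k = false].
    by move: aB; rewrite !inE !negb_or => /and3P[/negPf-> /negPf-> /negPf->].
  have [bi bj bk] : [/\ b == i = false, b == j = false & b == k = false].
    by move: bB; rewrite !inE !negb_or => /and3P[/negPf-> /negPf-> /negPf->].
  (* As ij vanishes, the four-point condition bounds the expression for ab below by that for ai plus
     bj, or for aj plus bi, all nonnegative. *)
  have : uniq [:: a; b; i; j].
    by rewrite /= !inE (negPf ab) ai aj bi bj (negPf nij).
  move=> /four_point; rewrite /u ai aj ak bi bj bk.
  have [ai' aj' _] := vge a; have [bi' bj' _] := vge b.
  rewrite (Wsym a i) (Wsym a j) (Wsym b i) (Wsym b j); lra.
(* The pair of l with i, j or k vanishes exactly when that point attains the maximum [v l]; this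
   compares the three pairings of i, j, k, l. *)
rewrite ulE; have [vi vj vk] := vge l.
split; apply/eqP/andP => [e|[h1 h2]]; try (by split; lra);
  by case: (veq l) => e; lra.
Qed.

End TreeMetrics.

(** * Noncrossing multisets of arcs are determined by their endpoint counts *)

Section NoncrossingArcs.
Variables (V E : finType) (pos : V -> nat) (lo hi : E -> V).
Hypothesis pos_inj : injective pos.
Hypothesis arc_inj : forall e f, lo e = lo f -> hi e = hi f -> e = f.

Definition crossing (a b : E) :=
  [&& pos (lo a) < pos (lo b), pos (lo b) < pos (hi a) & pos (hi a) < pos (hi b)].

Definition noncrossing (m : E -> nat) :=
  [forall a, forall b, (0 < m a) ==> (0 < m b) ==> ~~ crossing a b].

Lemma leq_sum_exists (P : pred E) (m m' : E -> nat) e :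
  \sum_(f | P f) m f = \sum_(f | P f) m' f -> P e -> m' e < m e ->
  exists2 f, P f & m f < m' f.
Proof.
move=> eqm Pe lte.
have [/existsP[f /andP[Pf lf]]|] := boolP [exists f, P f && (m f < m' f)].
  by exists f.
rewrite negb_exists => /forallP nle.
suff : \sum_(f | P f) m' f < \sum_(f | P f) m f by rewrite eqm ltnn.
rewrite (bigD1 e) //= [X in _ < X](bigD1 e) //= -addSn leq_add // leq_sum //.
by move=> f /andP[Pf _]; have := nle f; rewrite Pf -leqNgt.
Qed.

(* Let e be the shortest arc on which m and m' differ. Where e is less frequent,
   two longer arcs make up for it, one at each endpoint of e, and these cross. *)
Lemma noncrossing_inj (m m' : E -> nat) : noncrossing m -> noncrossing m' ->
  (forall e, pos (lo e) < pos (hi e)) ->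
  (forall i, \sum_(e | lo e == i) m e = \sum_(e | lo e == i) m' e) ->
  (forall i, \sum_(e | hi e == i) m e = \sum_(e | hi e == i) m' e) ->
  m =1 m'.
Proof.
move=> ncm ncm' ltarc; move: m m' ncm ncm'.
pose len e := pos (hi e) - pos (lo e).
suff short m m' e : noncrossing m' ->
    (forall i, \sum_(f | lo f == i) m f = \sum_(f | lo f == i) m' f) ->
    (forall i, \sum_(f | hi f == i) m f = \sum_(f | hi f == i) m' f) ->
    m' e < m e -> ~ (forall f, m f != m' f -> len e <= len f).
  move=> m m' ncm ncm' eqlo eqhi e0; apply/eqP; apply: contraT => ne0.
  case: (arg_minnP (P := fun e => m e != m' e) len ne0) => e ne emin.
  have [lt|gt] : m' e < m e \/ m e < m' e by apply/orP; rewrite -neq_ltn eq_sym.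
    by case: (short m m' e).
  by case: (short m' m e) => // f; rewrite eq_sym; apply: emin.
move=> ncm' eqlo eqhi lte emin.
have [f /eqP lof ltf] := leq_sum_exists (eqlo (lo e)) (eqxx _) lte.
have [g /eqP hig ltg] := leq_sum_exists (eqhi (hi e)) (eqxx _) lte.
have fe : hi f <> hi e by move=> h; move: ltf lte; rewrite (arc_inj lof h); lia.
have ge : lo g <> lo e by move=> h; move: ltg lte; rewrite (arc_inj h hig); lia.
have hf : pos (hi f) != pos (hi e) by apply: contra_not_neq fe => /pos_inj.
have hg : pos (lo g) != pos (lo e) by apply: contra_not_neq ge => /pos_inj.
have lf := emin f; have lg := emin g.
(* Both g and f occur in m'; g starts before e and ends with it, f starts with e and ends after
   it. *)
move/forallP/(_ g)/forallP/(_ f): ncm'.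
rewrite (leq_ltn_trans _ ltg) // (leq_ltn_trans _ ltf) //= /crossing.
rewrite lof hig ltarc /=; move: (ltarc e) (ltarc f) (ltarc g) hf hg.
rewrite /len lof hig in lf lg *.
have {}lf : pos (hi e) - pos (lo e) <= pos (hi f) - pos (lo e) by apply: lf; lia.
have {}lg : pos (hi e) - pos (lo e) <= pos (hi e) - pos (lo g) by apply: lg; lia.
lia.
Qed.

End NoncrossingArcs.

(** * Unique terms of lowest weight *)

Section LowestTerms.
Local Open Scope ring_scope.
Variables (R : realType) (E : finType) (v : {ffun E -> R^o}).
Implicit Types (p q : polyring R E) (m k : 'X_{1..#|E|}).

(** A weight may have ties, so uniqueness of the lowest monomial is demanded here; this makes the
    notion multiplicative. *)
Definition lowest p m := p@_m != 0 /\
  forall k, k \in msupp p -> k != m -> wweight v m < wweight v k.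

Lemma lowest_le p m k : lowest p m -> k \in msupp p -> wweight v m <= wweight v k.
Proof. by move=> [_ pm] kp; have [->//|/(pm _ kp)/ltW] := eqVneq k m. Qed.

Lemma lowest1 : lowest 1 0%MM.
Proof.
split; first by rewrite mcoeff1 eqxx oner_neq0.
by move=> k; rewrite msupp1 inE => /eqP->; rewrite eqxx.
Qed.

Lemma lowestM p q m k : lowest p m -> lowest q k -> lowest (p * q) (m + k)%MM.
Proof.
move=> pm qk; split.
  (* The second product has only monomials of weight above that of m + k, so the coefficient there
     is the product of the two lowest coefficients. *)
  have -> : p * q = p@_m *: (q * 'X_[m]) + (p - p@_m *: 'X_[m]) * q.
    by rewrite -!mul_mpolyC; ring.
  rewrite mcoeffD mcoeffZ mcoeffMX.
  rewrite [X in _ + X]memN_msupp_eq0 ?addr0.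
    by rewrite mulf_neq0 //; [case: pm|case: qk].
  apply/negP => /msuppM_le/allpairsP[[a b] /= [ap bq e]].
  have [am ap'] : a != m /\ a \in msupp p.
    move: ap; rewrite !mcoeff_msupp mcoeffB mcoeffZ mcoeffX [m == a]eq_sym.
    by case: (eqVneq a m) => [->|_]; rewrite ?mulr1 ?subrr ?eqxx // mulr0 subr0.
  have := ltr_leD (pm.2 _ ap' am) (lowest_le qk bq).
  by rewrite -!wweightD -e ltxx.
move=> h /msuppM_le/allpairsP[[a b] /= [ap bq ->]] ne; rewrite !wweightD.
have [am|am] := eqVneq a m.
  by rewrite am in ne *; rewrite ltrD2l qk.2 //; apply: contraNneq ne => ->.
exact: ltr_leD (pm.2 _ ap am) (lowest_le qk bq).
Qed.

Lemma lowest_exp p m j : lowest p m -> lowest (p ^+ j) (m *+ j)%MM.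
Proof.
move=> pm; elim: j => [|j IHj]; first by rewrite expr0 mulm0n; apply: lowest1.
by rewrite exprS mulmS; apply: lowestM.
Qed.

Lemma lowest_prod (I : finType) (P : I -> polyring R E) (mu : I -> 'X_{1..#|E|}) :
  (forall i, lowest (P i) (mu i)) -> lowest (\prod_i P i) (\sum_i mu i)%MM.
Proof.
move=> Pmu; apply: (big_ind2 lowest) => //; first exact: lowest1.
by move=> *; apply: lowestM.
Qed.

End LowestTerms.

(** * Three-term Plücker relations *)

Section PlueckerRelations.
Local Open Scope ring_scope.
Local Open Scope classical_set_scope.
Variables (R : realType) (n : nat) (e0 : pairs n).
Implicit Types (i j k l a b : 'I_n) (e : pairs n) (m : 'X_{1..#|pairs n|}).

Let I := pluecker_ideal R n.
Let idI : is_ideal I. Proof. exact: pluecker_ideal_is_ideal. Qed.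

(* The default e0 is only the value for i = j. *)
Definition arc i j : pairs n := insubd e0 (if (i < j)%N then (i, j) else (j, i)).

Lemma val_arc i j : i != j -> val (arc i j) = if (i < j)%N then (i, j) else (j, i).
Proof.
move=> ij; rewrite insubdK // unfold_in.
by case: (ltngtP i j) => // /val_inj e; rewrite e eqxx in ij.
Qed.

Lemma arcC i j : arc i j = arc j i.
Proof. by rewrite /arc; case: ltngtP => // /val_inj ->. Qed.

Lemma arc_val e : arc (val e).1 (val e).2 = e.
Proof.
apply: val_inj; have lt := valP e.
rewrite val_arc ?lt; first by case: (val e).
by apply: contraTneq lt => /= ->; rewrite ltnn.
Qed.

Definition arcs i j k l : 'X_{1..#|pairs n|} :=
  (U_(enum_rank (arc i j)) + U_(enum_rank (arc k l)))%MM.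

(** Signs of the antisymmetric extension x_ji = -x_ij, in which the three-term relation has one
    shape for every order of the indices. *)
Let sgn i j : complex R := (-1) ^+ (j < i)%N.
Let svar i j : polyring R (pairs n) := sgn i j *: pvar (arc i j).

Let map_svar i j : i != j -> pluecker_map (svar i j) =
  pvar ((0, i) : entries n) * pvar ((1, j) : entries n) -
  pvar ((0, j) : entries n) * pvar ((1, i) : entries n).
Proof.
move=> ij; rewrite linearZ /= pluecker_mapU /pluecker_minor val_arc // /sgn.
case: (ltngtP i j) => [lt|lt|/val_inj e] /=; last by rewrite e eqxx in ij.
  by rewrite expr0 scale1r.
by rewrite expr1 scaleN1r opprB.
Qed.

Let svarM i j k l : svar i j * svar k l = (sgn i j * sgn k l) *: 'X_[arcs i j k l].
Proof. by rewrite /svar -scalerAl -scalerAr scalerA mpolyXD. Qed.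

Lemma three_term_relation i j k l : uniq [:: i; j; k; l] ->
  exists s t : complex R, I ('X_[arcs i k j l] -
    (s *: 'X_[arcs i j k l] + t *: 'X_[arcs i l j k])).
Proof.
rewrite /= !inE !negb_or andbT => /and3P[/and3P[ij ik il] /andP[jk jl] kl].
exists (sgn i k * sgn j l * (sgn i j * sgn k l)), (sgn i k * sgn j l * (sgn i l * sgn j k)).
set c := sgn i k * sgn j l.
have c2 : c * c = 1.
  by rewrite /c /sgn mulrACA -!expr2 !sqrr_sign mulr1.
have -> : 'X_[arcs i k j l] = c *: (svar i k * svar j l).
  by rewrite svarM scalerA c2 scale1r.
rewrite -!(scalerA c) -!svarM -scalerDr -scalerBr /I /pluecker_ideal /=.
rewrite linearZ /= rmorphB rmorphD !rmorphM /= !map_svar //.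
by rewrite [X in _ *: X](_ : _ = 0) ?scaler0 //; ring.
Qed.

(** * The four-point condition and initial forms of the relations *)

Variable w : {ffun pairs n -> R^o}.
Let W i j : R := w (arc i j).

Lemma wweight_arcs i j k l : wweight w (arcs i j k l) = W i j + W k l.
Proof. by rewrite wweightD !wweightU. Qed.

(** If x_ij x_kl were strictly lighter than the two other products, it would be the initial form of
    the three-term relation, up to a scalar. *)
Lemma four_point_of_monomial_free :
  (forall m, ~ initial_ideal w I 'X_[m]) ->
  forall i j k l, uniq [:: i; j; k; l] ->
    W i k + W j l <= W i j + W k l \/ W i l + W j k <= W i j + W k l.
Proof.
move=> mfree i j k l uijkl.
have [le|lt1] := leP (W i k + W j l) (W i j + W k l); first by left.
have [le|lt2] := leP (W i l + W j k) (W i j + W k l); first by right.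
have [s [t]] : exists s t : complex R, I ('X_[arcs i j k l] -
    (s *: 'X_[arcs i k j l] + t *: 'X_[arcs i l k j])).
  apply: three_term_relation; move: uijkl; rewrite /= !inE !negb_or (eq_sym j k).
  by rewrite !andbT => /and3P[/and3P[-> -> ->] /andP[-> ->] ->].
set m0 := arcs i j k l; set m1 := arcs i k j l; set m2 := arcs i l k j.
have {}lt1 : wweight w m0 < wweight w m1 by rewrite !wweight_arcs.
have {}lt2 : wweight w m0 < wweight w m2 by rewrite !wweight_arcs /W (arcC k j).
set p := (_ - _) => Ip; case: (mfree m0).
have pE : initial_form w p = mpart (fun m => wweight w m == wweight w m0) p.
  apply: initial_formE => [|m].
    rewrite mcoeff_msupp mcoeffB mcoeffD !mcoeffZ !mcoeffX eqxx.
    have [e|_] := eqVneq m1 m0; first by rewrite e ltxx in lt1.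
    have [e|_] := eqVneq m2 m0; first by rewrite e ltxx in lt2.
    by rewrite !mulr0 addr0 subr0 oner_neq0.
  move=> /msuppB_le; rewrite mem_cat msuppX inE => /orP[/eqP->//|/msuppD_le].
  rewrite mem_cat => /orP[] /msuppZ_le; rewrite msuppX inE => /eqP->; exact: ltW.
suff <- : initial_form w p = 'X_[m0] by apply: mem_initial_ideal.
rewrite pE linearB linearD !linearZ /= !mpartX eqxx (gt_eqF lt1) (gt_eqF lt2).
by rewrite !scaler0 addr0 subr0.
Qed.

Hypothesis four_point : forall i j k l, uniq [:: i; j; k; l] ->
  W i k + W j l <= W i j + W k l \/ W i l + W j k <= W i j + W k l.

Let J := subd_ideal w I.

Lemma mnm_in_arcs D i j k l :
  mnm_in D (arcs i j k l) = (arc i j \in D) && (arc k l \in D).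
Proof.
apply/forallP/andP => [arcsD|[ijD klD] e]; last first.
  have [<-|ne1] := eqVneq (arc i j) e; first by rewrite ijD implybT.
  have [<-|ne2] := eqVneq (arc k l) e; first by rewrite klD implybT.
  by rewrite mnmDE !mnm1E !(inj_eq enum_rank_inj) (negPf ne1) (negPf ne2).
by split; apply: (implyP (arcsD _)); rewrite mnmDE !mnm1E eqxx ?addn_eq0 ?andbF.
Qed.

(** The cell of [tree_point] contains ij, ik and jk, and an arc from l exactly when the product
    containing that arc has minimal weight. So [rho] keeps exactly the minimal terms of the
    relation. *)
Lemma initial_three_term_relation i j k l : uniq [:: i; j; k; l] ->
  W i k + W j l <= W i j + W k l -> W i k + W j l <= W i l + W j k ->
  let m := arcs i k j l in let m1 := arcs i j k l in let m2 := arcs i l j k in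
  exists s t : complex R, I ('X_[m] - (s *: 'X_[m1] + t *: 'X_[m2])) /\
    J ('X_[m] - ((if wweight w m1 == wweight w m then s else 0) *: 'X_[m1] +
                 (if wweight w m2 == wweight w m then t else 0) *: 'X_[m2])).
Proof.
move=> uijkl le1 le2 m m1 m2; have [s [t Irel]] := three_term_relation uijkl.
exists s, t; split=> //.
have Wsym a b : W a b = W b a by rewrite /W arcC.
have [u [u_ge0 uij uik ujk [uil ujl ukl]]] := tree_point Wsym four_point uijkl.
have uL := lineality_pluecker u; set lu := [ffun e => _] in uL.
have luE a b : a != b -> lu (arc a b) = u a + u b.
  by move=> ab; rewrite ffunE val_arc //; case: ifP => _ //; rewrite addrC.
move: uijkl; rewrite /= !inE !negb_or andbT => /and3P[/and3P[ij ik il] /andP[jk jl] kl].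
pose D : {set pairs n} := [set e | w e + lu e == 0]%SET.
have luij : w (arc i j) + lu (arc i j) = 0 by rewrite luE.
have DJ : subd w (lineality_config I) D.
  apply: (subd_lineality (e0 := arc i j)) uL _ _ => e; rewrite luij; last by rewrite inE.
  rewrite -[e]arc_val; have lt := valP e.
  have ne : (val e).1 != (val e).2 by apply: contraTneq lt => /= ->; rewrite ltnn.
  by rewrite luE // u_ge0.
have inD a b : a != b -> (arc a b \in D) = (W a b + (u a + u b) == 0).
  by move=> ab; rewrite inE luE.
have : J (rho D ('X_[m] - (s *: 'X_[m1] + t *: 'X_[m2]))).
  by apply: sub_ideal_gen; exists D => //; exists ('X_[m] - (s *: 'X_[m1] + t *: 'X_[m2])).
rewrite rhoE linearB linearD !linearZ /= !mpartX !mnm_in_arcs !inD //.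
rewrite uij uik ujk !eqxx uil ujl ukl le1 le2 !wweight_arcs /= andbT.
have -> : (W i j + W k l <= W i k + W j l) && (W i j + W k l <= W i l + W j k) =
    (W i j + W k l == W i k + W j l).
  by rewrite eq_le le1 andbT; case: leP => // h; rewrite (le_trans h le2).
have -> : (W i l + W j k <= W i j + W k l) && (W i l + W j k <= W i k + W j l) =
    (W i l + W j k == W i k + W j l).
  by rewrite eq_le le2 andbT andbC; case: leP => // h; rewrite (le_trans h le1).
by do 2 case: ifP; rewrite ?scaler0 ?scale0r.
Qed.

(** * Straightening along the circular order *)

Variable pos : 'I_n -> nat.
Hypothesis pos_inj : injective pos.
Hypothesis pos_crossing : forall i j k l,
  (pos i < pos j)%N -> (pos j < pos k)%N -> (pos k < pos l)%N ->
  W i k + W j l <= W i j + W k l /\ W i k + W j l <= W i l + W j k.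

(** Endpoints are sorted by [pos], not by the numerical order built into [pairs]. *)
Let lo e := if (pos (val e).1 < pos (val e).2)%N then (val e).1 else (val e).2.
Let hi e := if (pos (val e).1 < pos (val e).2)%N then (val e).2 else (val e).1.

Let arc_lohi e : arc (lo e) (hi e) = e.
Proof. by rewrite /lo /hi; case: ifP => _; [|rewrite arcC]; apply: arc_val. Qed.

Let lt_lohi e : (pos (lo e) < pos (hi e))%N.
Proof.
rewrite /lo /hi; case: (ltngtP (pos (val e).1) (pos (val e).2)) => // /pos_inj h.
by have := valP e; rewrite /= h ltnn.
Qed.

Let lohi_inj e e' : lo e = lo e' -> hi e = hi e' -> e = e'.
Proof. by move=> h1 h2; rewrite -(arc_lohi e) h1 h2 arc_lohi. Qed.

Let lohi_arc i j : (pos i < pos j)%N -> lo (arc i j) = i /\ hi (arc i j) = j.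
Proof.
move=> lt; have ij : i != j by apply: contraTneq lt => ->; rewrite ltnn.
rewrite /lo /hi val_arc //; case: (i < j)%N => /=; first by rewrite lt.
by rewrite ltnNge ltnW.
Qed.

Let nc m := noncrossing pos lo hi (fun e => m (enum_rank e)).

(* A strictly concave function of the length of an arc decreases in total when
   two crossing arcs are uncrossed, in either way. *)
Let N := (\sum_i pos i).+1.
Let len e := (pos (hi e) - pos (lo e))%N.
Let height m := (\sum_e m (enum_rank e) * (len e * (N - len e)))%N.

Let heightD m1 m2 : height (m1 + m2)%MM = (height m1 + height m2)%N.
Proof.
rewrite /height -big_split /=; apply: eq_bigr => e _.
by rewrite mnmDE mulnDl.
Qed.

Let heightU i j : (pos i < pos j)%N -> height U_(enum_rank (arc i j))%MM =
  ((pos j - pos i) * (N - (pos j - pos i)))%N.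
Proof.
move=> lt; have [loE hiE] := lohi_arc lt.
rewrite /height (bigD1 (arc i j)) //= big1 => [|e ne].
  by rewrite mnm1E eqxx mul1n addn0 /len loE hiE.
by rewrite mnm1E (inj_eq enum_rank_inj) eq_sym (negPf ne).
Qed.

Let height_uncross i j k l :
  (pos i < pos j)%N -> (pos j < pos k)%N -> (pos k < pos l)%N ->
  (height (arcs i j k l) < height (arcs i k j l))%N /\
  (height (arcs i l j k) < height (arcs i k j l))%N.
Proof.
move=> ij jk kl; have ik := ltn_trans ij jk; have jl := ltn_trans jk kl.
have il := ltn_trans ij jl; rewrite !heightD !heightU //.
have : (pos l < N)%N by rewrite ltnS (bigD1 l) //= leq_addr.
have [p pE] : exists p, pos j = (pos i + p)%N by exists (pos j - pos i)%N; lia.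
have [q qE] : exists q, pos k = (pos j + q)%N by exists (pos k - pos j)%N; lia.
have [r rE] : exists r, pos l = (pos k + r)%N by exists (pos l - pos k)%N; lia.
move=> lN; have [x xE] : exists x, N = (p + q + r + x).+1.
  by exists (N - (p + q + r).+1)%N; lia.
have -> : (pos j - pos i = p)%N by lia.
have -> : (pos l - pos k = r)%N by lia.
have -> : (pos k - pos i = p + q)%N by lia.
have -> : (pos l - pos j = q + r)%N by lia.
have -> : (pos l - pos i = p + q + r)%N by lia.
have -> : (pos k - pos j = q)%N by lia.
have -> : (N - p = q + r + x + 1)%N by lia.
have -> : (N - r = p + q + x + 1)%N by lia.
have -> : (N - (p + q) = r + x + 1)%N by lia.
have -> : (N - (q + r) = p + x + 1)%N by lia.
have -> : (N - (p + q + r) = x + 1)%N by lia.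
have -> : (N - q = p + r + x + 1)%N by lia.
have p0 : (0 < p)%N by lia.
have q0 : (0 < q)%N by lia.
have r0 : (0 < r)%N by lia.
(* The two drops in height are 2q(x+1) and 2pr; the first is positive because N exceeds every
   position. *)
clear -p0 q0 r0; split; nia.
Qed.

Let idJ : is_ideal J. Proof. exact: ideal_gen_ideal. Qed.

Let idealZ (K : set (polyring R (pairs n))) c p : is_ideal K -> K p -> K (c *: p).
Proof. by move=> idK Kp; rewrite -mul_mpolyC; apply: idealM. Qed.

(** Induction on [height]: a crossing pair in m is uncrossed by a three-term relation. The same
    rewriting is followed modulo I with all terms, and modulo J with only the terms of the weight of
    m. *)
Lemma straightening m : exists f : polyring R (pairs n),
  [/\ I ('X_[m] - f), {in msupp f, forall m', nc m'},
      {in msupp f, forall m', wweight w m <= wweight w m'} &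
      J ('X_[m] - mpart (fun m' => wweight w m' == wweight w m) f)].
Proof.
have [h] := ubnP (height m); elim: h m => // h IHh m lemh.
have [ncm|] := boolP (nc m).
  exists 'X_[m]; rewrite mpartX eqxx subrr; split.
  - exact: ideal0.
  - by move=> m'; rewrite msuppX inE => /eqP->.
  - by move=> m'; rewrite msuppX inE => /eqP->.
  - exact: ideal0.
rewrite negb_forall => /existsP[a]; rewrite negb_forall => /existsP[b].
rewrite !negb_imply => /and4P[ma mb /and3P[]].
set i := lo a; set j := lo b; set k := hi a; set l := hi b => ij jk kl _.
have ab : a != b by apply: contraTneq ij => e; rewrite /i /j e ltnn.
have [m0 mE] : exists m0, m = (m0 + arcs i k j l)%MM.
  exists (m - arcs i k j l)%MM; rewrite submK //; apply/mnm_lepP => x.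
  rewrite /arcs !arc_lohi mnmDE !mnm1E.
  have [<-|_] := eqVneq (enum_rank a) x.
    by rewrite (inj_eq enum_rank_inj) eq_sym (negPf ab).
  by have [<-|_] := eqVneq (enum_rank b) x.
have [ht1 ht2] := height_uncross ij jk kl.
have [le1 le2] := pos_crossing ij jk kl.
have uijkl : uniq [:: i; j; k; l].
  have ne c d : (pos c < pos d)%N -> c == d = false.
    by move=> lt; apply: contraTF lt => /eqP->; rewrite ltnn.
  by rewrite /= !inE !ne // ?(ltn_trans ij) // ?(ltn_trans jk).
have [s [t [Irel Jrel]]] := initial_three_term_relation uijkl le1 le2.
set m1 := arcs i j k l in ht1 Irel Jrel; set m2 := arcs i l j k in ht2 Irel Jrel.
set mc := arcs i k j l in mE ht1 ht2 Irel Jrel.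
have [|f1 [If1 nc1 w1 Jf1]] := IHh (m0 + m1)%MM.
  by apply: (@leq_trans (height m)); rewrite // mE !(heightD m0) ltn_add2l.
have [|f2 [If2 nc2 w2 Jf2]] := IHh (m0 + m2)%MM.
  by apply: (@leq_trans (height m)); rewrite // mE !(heightD m0) ltn_add2l.
have le1' : wweight w m <= wweight w (m0 + m1)%MM.
  by rewrite mE !(wweightD w m0) lerD2l !wweight_arcs.
have le2' : wweight w m <= wweight w (m0 + m2)%MM.
  by rewrite mE !(wweightD w m0) lerD2l !wweight_arcs.
have eq1 : (wweight w m1 == wweight w mc) = (wweight w (m0 + m1)%MM == wweight w m).
  by rewrite mE !(wweightD w m0) (inj_eq (addrI _)).
have eq2 : (wweight w m2 == wweight w mc) = (wweight w (m0 + m2)%MM == wweight w m).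
  by rewrite mE !(wweightD w m0) (inj_eq (addrI _)).
rewrite eq1 eq2 in Jrel.
(* A normal form of m' has no weight below that of m', so if m' is heavier than m it contributes
   nothing in the weight of m. *)
have partE m' (f : polyring R (pairs n)) : wweight w m <= wweight w m' ->
    {in msupp f, forall m1, wweight w m' <= wweight w m1} ->
    mpart (fun m1 => wweight w m1 == wweight w m) f =
    if wweight w m' == wweight w m
    then mpart (fun m1 => wweight w m1 == wweight w m') f else 0.
  move=> lem' wf; case: eqP => [->//|/eqP ne]; apply: mpart_pred0 => x /wf xf.
  by rewrite gt_eqF // (lt_le_trans _ xf) // lt_neqAle eq_sym ne.
exists (s *: f1 + t *: f2); split.
- have -> : 'X_[m] - (s *: f1 + t *: f2) =
      'X_[m0] * ('X_[mc] - (s *: 'X_[m1] + t *: 'X_[m2])) +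
      (s *: ('X_[m0 + m1] - f1) + t *: ('X_[m0 + m2] - f2)).
    by rewrite mE !mpolyXD -!mul_mpolyC; ring.
  exact: (idealD idI (idealM idI _ Irel) (idealD idI (idealZ _ idI If1) (idealZ _ idI If2))).
- by move=> x /msuppD_le; rewrite mem_cat => /orP[] /msuppZ_le; [apply: nc1|apply: nc2].
- move=> x /msuppD_le; rewrite mem_cat => /orP[] /msuppZ_le.
    by move/w1; apply: le_trans.
  by move/w2; apply: le_trans.
rewrite linearD !linearZ /= (partE _ f1 le1' w1) (partE _ f2 le2' w2).
set g1 := mpart _ f1 in Jf1 *; set g2 := mpart _ f2 in Jf2 *.
set b1 := _ == _ in Jrel *; set b2 := _ == wweight w m in Jrel *.
move: b1 b2 Jrel => b1 b2 Jrel.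
have -> : 'X_[m] - (s *: (if b1 then g1 else 0) + t *: (if b2 then g2 else 0)) =
    'X_[m0] * ('X_[mc] - ((if b1 then s else 0) *: 'X_[m1] + (if b2 then t else 0) *: 'X_[m2])) +
    ((if b1 then s else 0) *: ('X_[m0 + m1] - g1) +
     (if b2 then t else 0) *: ('X_[m0 + m2] - g2)).
  by clear Jrel; rewrite mE !mpolyXD; case: b1; case: b2; rewrite -!mul_mpolyC ?mpolyC0; ring.
exact: (idealD idJ (idealM idJ _ Jrel) (idealD idJ (idealZ _ idJ Jf1) (idealZ _ idJ Jf2))).
Qed.

(** * Independence of noncrossing monomials modulo the Plücker ideal *)

Let v : {ffun entries n -> R^o} := [ffun x => if x.1 == 0 then (pos x.2)%:R else 0].

Let zmnm (b : 'I_2) i : 'X_{1..#|entries n|} :=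
  U_(enum_rank ((b, i) : entries n))%MM.

Let lohi_mnm e : 'X_{1..#|entries n|} :=
  (zmnm 0%R (lo e) + zmnm 1%R (hi e))%MM.

Let lowmnm m : 'X_{1..#|entries n|} := (\sum_e lohi_mnm e *+ m (enum_rank e))%MM.

(** Only first-row entries have weight, growing with [pos], so the lighter product of the minor
    takes its first-row factor in column [lo e]. *)
Let lowest_minor e : lowest v (pluecker_minor R e) (lohi_mnm e).
Proof.
have lt := lt_lohi e.
have wE a b : wweight v (zmnm 0%R a + zmnm 1%R b)%MM = (pos a)%:R.
  by rewrite wweightD !wweightU !ffunE /= addr0.
pose m' : 'X_{1..#|entries n|} := 
  (zmnm 0%R (hi e) + zmnm 1%R (lo e))%MM.
have ltw : wweight v (lohi_mnm e) < wweight v m' by rewrite !wE ltr_nat.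
have ne : m' != lohi_mnm e by apply: contraTneq ltw => ->; rewrite ltxx.
suff [c c0 ->] : exists2 c : complex R, c != 0 &
    pluecker_minor R e = c *: ('X_[lohi_mnm e] - 'X_[m']).
  split; first by rewrite mcoeffZ mcoeffB !mcoeffX eqxx (negPf ne) subr0 mulr1.
  move=> h /msuppZ_le/msuppB_le; rewrite mem_cat !msuppX !inE.
  by case/orP => /eqP->; rewrite ?eqxx.
rewrite /pluecker_minor /lohi_mnm /m' /lo /hi !mpolyXD; case: (val e) => i j /=.
case: ifP => _; first by exists 1; rewrite ?oner_neq0 ?scale1r.
by exists (-1); rewrite ?oppr_eq0 ?oner_neq0 // scaleN1r opprB.
Qed.

Let lowest_monomial m : lowest v (pluecker_map 'X_[m]) (lowmnm m).
Proof.
rewrite pluecker_mapX; apply: lowest_prod => e.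
exact: lowest_exp (lowest_minor e).
Qed.

(** The exponents of first-row entries count arcs by [lo], those of second-row entries by [hi], and
    [noncrossing_inj] applies. *)
Let lowmnm_inj m m' : nc m -> nc m' -> lowmnm m = lowmnm m' -> m = m'.
Proof.
move=> ncm ncm' e.
have lowE0 m1 i : lowmnm m1 (enum_rank ((0, i) : entries n)) =
    (\sum_(f | lo f == i) m1 (enum_rank f))%N.
  rewrite mnm_sumE [RHS]big_mkcond; apply: eq_bigr => f _.
  rewrite mulmnE mnmDE !mnm1E !(inj_eq enum_rank_inj) !xpair_eqE /= addn0.
  by case: eqP => _; rewrite ?mul1n ?mul0n.
have lowE1 m1 i : lowmnm m1 (enum_rank ((1, i) : entries n)) =
    (\sum_(f | hi f == i) m1 (enum_rank f))%N.
  rewrite mnm_sumE [RHS]big_mkcond; apply: eq_bigr => f _.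
  rewrite mulmnE mnmDE !mnm1E !(inj_eq enum_rank_inj) !xpair_eqE /= add0n.
  by case: eqP => _; rewrite ?mul1n ?mul0n.
have mm' : (fun f => m (enum_rank f)) =1 (fun f => m' (enum_rank f)).
  apply: (noncrossing_inj pos_inj lohi_inj ncm ncm') => // i.
    by rewrite -lowE0 e lowE0.
  by rewrite -lowE1 e lowE1.
by apply/mnmP => x; rewrite -(enum_valK x); apply: mm'.
Qed.

Lemma noncrossing_independent f : I f -> {in msupp f, forall m', nc m'} -> f = 0.
Proof.
move=> If ncf; apply/eqP; apply: contraT; rewrite -msupp_eq0.
move=> /(seq_min (fun m => wweight v (lowmnm m)))[k kf kmin].
have : (pluecker_map f)@_(lowmnm k) = 0 by rewrite [pluecker_map f]If mcoeff0.
rewrite pluecker_mapE linear_sum /= (bigD1_seq k) ?msupp_uniq //= big1_seq.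
  rewrite addr0 mcoeffZ => /eqP; rewrite mulf_eq0 (negPf (lowest_monomial k).1) orbF.
  by rewrite -[_ == 0]negbK -mcoeff_msupp kf.
(* The lowest monomial of the image of k cannot cancel: the image of h has a different lowest
   monomial, of no smaller weight, and its other monomials are heavier still. *)
move=> h /andP[hk hf]; rewrite mcoeffZ [X in _ * X]memN_msupp_eq0 ?mulr0 //.
apply/negP => /(lowest_monomial h).2 lt.
have /lt : lowmnm k != lowmnm h.
  by apply: contra_neq hk => e; apply/esym; apply: lowmnm_inj => //; apply: ncf.
by rewrite ltNge kmin.
Qed.

Lemma sub_initial_subd_ideal : initial_ideal w I `<=` J.
Proof.
apply: ideal_gen_min => // _ [g Ig <-].
have [->|g0] := eqVneq g 0; first by rewrite initial_form0; apply: ideal0.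
have [h hg [hmin ->]] := initial_formP w g0.
have [F FP] := choice straightening.
(* The normal form of g lies in I and is noncrossing, hence is 0. *)
have F0 : \sum_(m <- msupp g) g@_m *: F m = 0.
  apply: noncrossing_independent.
    have -> : \sum_(m <- msupp g) g@_m *: F m =
        g - \sum_(m <- msupp g) g@_m *: ('X_[m] - F m).
      under [in RHS]eq_bigr do rewrite scalerBr.
      by rewrite sumrB -mpolyE subKr.
    apply: (idealB idI Ig); apply: (ideal_sum idI) => m _.
    by apply: (idealZ _ idI); case: (FP m).
  pose NC (p : polyring R (pairs n)) := {in msupp p, forall m', nc m'}.
  apply: (big_ind NC) => [m|p q ncp ncq m|m _ m' /msuppZ_le].
  - by rewrite msupp0.
  - by move/msuppD_le; rewrite mem_cat => /orP[/ncp|/ncq].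
  - by case: (FP m) => _ + _ _; apply.
pose top m := wweight w m == wweight w h.
pose Fin m := mpart (fun m' => wweight w m' == wweight w m) (F m).
(* Take the part of least weight in [F0]: monomials of g of larger weight do not reach it. The
   initial form of g is thus a combination of differences lying in J. *)
have Fin0 : \sum_(m <- msupp g | top m) g@_m *: Fin m = 0.
  transitivity (mpart top (\sum_(m <- msupp g) g@_m *: F m)); last first.
    by rewrite F0 linear0.
  rewrite linear_sum big_mkcond [LHS]big_seq [RHS]big_seq /=.
  apply: eq_bigr => m mg; rewrite linearZ /=; case: ifP => [/eqP e|topN].
    by congr (_ *: _); apply: eq_in_mpart => m' _; rewrite /top e.
  rewrite mpart_pred0 ?scaler0 // => m' m'F; have [_ _ /(_ _ m'F) le _] := FP m.
  rewrite /top gt_eqF // (lt_le_trans _ le) // lt_neqAle hmin // andbT.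
  by apply: contraFneq topN => e; rewrite /top e.
have -> : mpart (fun m => wweight w m == wweight w h) g =
    \sum_(m <- msupp g | top m) g@_m *: ('X_[m] - Fin m).
  under [RHS]eq_bigr do rewrite scalerBr.
  by rewrite sumrB Fin0 subr0.
apply: (ideal_sum idJ) => m _.
by apply: (idealZ _ idJ); case: (FP m).
Qed.

End PlueckerRelations.

(** * Equality of the two ideals *)

Theorem theorem3p7 (R : realType) (n : nat) (n_ge4 : (4 <= n)%N)
    (w : {ffun pairs n -> R^o}%R) :
  (forall m : 'X_{1..#|pairs n|},
     ~ initial_ideal w (pluecker_ideal R n) 'X_[m]%R) ->
  subd_ideal w (pluecker_ideal R n) = initial_ideal w (pluecker_ideal R n).
Proof.
move=> mfree.
have n_gt1 : (1 < n)%N by apply: leq_trans n_ge4.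
(* The pair (0, 1) serves as the default value of [arc]. *)
pose e0 : pairs n := exist (fun e : 'I_n * 'I_n => e.1 < e.2)%N
  (Ordinal (ltnW n_gt1), Ordinal n_gt1) isT.
have four_point := four_point_of_monomial_free e0 mfree.
have [|pos pos_inj posP] := circular_order _ four_point.
  by move=> i j; rewrite arcC.
rewrite eqEsubset; split.
  by apply: sub_subd_ideal_initial (pluecker_ideal_is_ideal R n) _;
     apply: homogeneous_pluecker.
exact: (sub_initial_subd_ideal four_point pos_inj posP).
Qed.
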